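(* Let $\Psi:\mathcal{X}\times\Theta\to\mathbb{R}^q$ be a regular inference function with components $\psi_1,\dots,\psi_q$. Then for all $\theta\in\Theta$ and $i\in\{1,\dots,q\}$, $$\psi_i(\cdot;\theta)\in\bigcap_{z\in\mathcal{Z}}T_N^\perp(\theta,z).$$
   Context: Setting. $\lambda$ is a $\sigma$-finite measure on a measurable space $(\mathcal{X},\mathcal{A})$; $\mathcal{P}^*=\{p(\cdot;\theta,z)=dP_{\theta z}/d\lambda:\theta\in\Theta,\ z\in\mathcal{Z}\}$ is a family of probability densities, $\Theta\subseteq\mathbb{R}^q$ is open, $\mathcal{Z}$ is an arbitrary set, $(\theta,z)\mapsto p(\cdot;\theta,z)$ is a bijection onto $\mathcal{P}^*$, and all densities are strictly positive. $L^2_0(P)$ is the space of $P$-square-integrable functions with $P$-mean zero. Nuisance tangent space. For $\theta\in\Theta$ let $\mathcal{P}^*_\theta=\{p(\cdot;\theta,z):z\in\mathcal{Z}\}$. The nuisance tangent set $T^0_N(\theta,z)$ is the set of $\nu\in L^2_0(P_{\theta z})$ for which there are a set $V\subseteq[0,\infty)$ containing $0$ and having $0$ as an accumulation point, a path $\{p_t\}_{t\in V}\subseteq\mathcal{P}^*_\theta$ and functions $\{r_t\}_{t\in V}\subseteq L^2(P_{\theta z})$ with $p_t=p+tp\nu+tpr_t$ for all $t\in V$, where $p=p(\cdot;\theta,z)$, and $\|r_t\|_{L^2(P_{\theta z})}\to0$ as $t\downarrow0$. $T_N(\theta,z)$ is the $L^2_0(P_{\theta z})$-closure of the linear span of $T_N^0(\theta,z)$,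 and $T_N^\perp(\theta,z)$ is its orthogonal complement in $L^2_0(P_{\theta z})$. Regular inference function. $\Psi:\mathcal{X}\times\Theta\to\mathbb{R}^q$, measurable in $x$, with components $\psi_1,\dots,\psi_q$, is a regular inference function if for all $\theta\in\Theta$, $z\in\mathcal{Z}$, $i,j\in\{1,\dots,q\}$: $\psi_i(\cdot;\theta)\in L^2_0(P_{\theta z})$; $\partial\psi_i(\cdot;\theta)/\partial\theta_j$ exists almost everywhere; $\frac{\partial}{\partial\theta_j}\int\psi_i(x;\theta)p(x;\theta,z)\lambda(dx)=\int\frac{\partial}{\partial\theta_j}[\psi_i(x;\theta)p(x;\theta,z)]\lambda(dx)$; the $q\times q$ matrix with entries $\mathrm{E}_{\theta z}\{\partial\psi_i(\cdot;\theta)/\partial\theta_j\}$ is well defined and nonsingular; and the $q\times q$ matrix $\mathrm{E}_{\theta z}\{\Psi(\cdot;\theta)\Psi^T(\cdot;\theta)\}$ is positive definite. *)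

(* Defs.v *)
From mathcomp Require Import all_boot all_order all_algebra.
From mathcomp Require Import all_classical all_reals all_analysis.

Set Implicit Arguments.
Unset Strict Implicit.
Unset Printing Implicit Defensive.

Import Order.TTheory GRing.Theory Num.Theory.
Import numFieldNormedType.Exports.

Local Open Scope classical_set_scope.
Local Open Scope ring_scope.

(* Elements of L^2(P) are represented by functions, not by classes modulo
   almost everywhere equality; this lets the same function be tested for
   membership in spaces attached to different probabilities. *)
Section L2.
Context (d : measure_display) (X : measurableType d) (R : realType).
Variable P : probability X R.

Definition L2 : set (X -> R) := [set f | f \in Lfun P 2%:E].

Definition L20 : set (X -> R) := [set f | L2 f /\ 'E_P[f]%E = 0%E].

Definition L2norm (f : X -> R) : \bar R := 'N[P]_2%:E[EFin \o f]%E.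

Definition L2inner (f g : X -> R) : R := \int[P]_x (f x * g x).

Definition linear_span (A : set (X -> R)) : set (X -> R) :=
  [set f | exists (n : nat) (a : 'I_n -> R) (g : 'I_n -> X -> R),
     (forall k, A (g k)) /\ f = (fun x => \sum_(k < n) a k * g k x)].

Definition L20_closure (A : set (X -> R)) : set (X -> R) :=
  [set f | L20 f /\
     forall e : R, 0 < e ->
       exists2 g, A g & (L2norm (fun x => (f x - g x)%R) < e%:E)%E].

Definition L20_orthogonal (A : set (X -> R)) : set (X -> R) :=
  [set f | L20 f /\ forall g, A g -> L2inner f g = 0].

End L2.

Section Model.
Context (d : measure_display) (X : measurableType d) (R : realType).
Variable lambda : {sigma_finite_measure set X -> \bar R}.
Variables (q : nat) (Theta : set 'cV[R]_q) (Z : Type).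
Variable P : 'cV[R]_q -> Z -> probability X R.
Variable p : 'cV[R]_q -> Z -> X -> R.

Definition density_family : set (X -> R) :=
  [set p a.1 a.2 | a in Theta `*` [set: Z]].

Definition density_subfamily (theta : 'cV[R]_q) : set (X -> R) :=
  [set p theta z | z in [set: Z]].

(* P and p are total in their first argument, but all requirements below
   concern parameters in Theta only. *)
Record is_model : Prop := IsModel {
  model_open : open Theta ;
  model_measurable : forall theta z, Theta theta ->
    measurable_fun [set: X] (p theta z) ;
  model_positive : forall theta z x, Theta theta -> 0 < p theta z x ;
  model_density : forall theta z, Theta theta ->
    forall A, measurable A ->
      P theta z A = (\int[lambda]_(x in A) (p theta z x)%:E)%E ;
  model_bijection :
    set_bij (Theta `*` [set: Z]) density_family (fun a => p a.1 a.2)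
}.

(* Since nu and r_t stand for elements of L^2, the expansion of p_t is an
   identity between functions up to lambda-null sets, equivalently up to
   P_{theta z}-null sets. *)
Definition nuisance_tangent_set (theta : 'cV[R]_q) (z : Z) : set (X -> R) :=
  [set nu | L20 (P theta z) nu /\
     exists (V : set R) (pt rt : R -> X -> R),
       [/\ V `<=` `[0, +oo[, V 0 & limit_point V 0] /\
       [/\ forall t, V t -> density_subfamily theta (pt t),
           forall t, V t -> L2 (P theta z) (rt t),
           forall t, V t -> {ae lambda, forall x,
             pt t x = p theta z x + t * p theta z x * nu x
                      + t * p theta z x * rt t x} &
           L2norm (P theta z) (rt t) @[t --> within V 0^'+] --> 0%E]].

Definition nuisance_tangent_space (theta : 'cV[R]_q) (z : Z) :
    set (X -> R) :=
  L20_closure (P theta z) (linear_span (nuisance_tangent_set theta z)).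

Definition nuisance_tangent_orthogonal (theta : 'cV[R]_q) (z : Z) :
    set (X -> R) :=
  L20_orthogonal (P theta z) (nuisance_tangent_space theta z).

(* g is a version of the lambda-almost everywhere defined function
   dF/dtheta_j at theta; versions are used, instead of the total operator
   derive, because the values of the latter where the derivative does not
   exist need not leave it measurable. *)
Definition partial_ae (F : X -> 'cV[R]_q -> R) (theta : 'cV[R]_q)
    (j : 'I_q) (g : X -> R) : Prop :=
  {ae lambda, forall x, is_derive theta (delta_mx j 0) (F x) (g x)}.

Definition positive_definite (A : 'M[R]_q) : Prop :=
  A^T = A /\ forall v : 'cV[R]_q, v != 0 -> 0 < (v^T *m A *m v) 0 0.

Record regular_inference_function (Psi : X -> 'cV[R]_q -> 'cV[R]_q) : Prop :=
  RegularInferenceFunction {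
  rif_measurable : forall theta i, Theta theta ->
    measurable_fun [set: X] (fun x => Psi x theta i 0) ;
  rif_L20 : forall theta z i, Theta theta ->
    L20 (P theta z) (fun x => Psi x theta i 0) ;
  rif_derivable : forall theta (z : Z) i j, Theta theta ->
    {ae lambda, forall x,
      derivable (fun theta' => Psi x theta' i 0) theta (delta_mx j 0)} ;
  (* existence of both sides of the interchange identity is part of it *)
  rif_interchange : forall theta z i j, Theta theta ->
    exists g : X -> R,
      [/\ partial_ae (fun x theta' => Psi x theta' i 0 * p theta' z x)
            theta j g,
          lambda.-integrable [set: X] (EFin \o g) &
          is_derive theta (delta_mx j 0)
            (fun theta' => \int[lambda]_x (Psi x theta' i 0 * p theta' z x))
            (\int[lambda]_x g x)] ;
  rif_sensitivity : forall theta z, Theta theta ->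
    exists S : 'M[R]_q,
      (forall i j, exists g : X -> R,
         [/\ partial_ae (fun x theta' => Psi x theta' i 0) theta j g,
             (P theta z).-integrable [set: X] (EFin \o g) &
             S i j = \int[P theta z]_x g x]) /\
      S \in unitmx ;
  rif_variability : forall theta z, Theta theta ->
    positive_definite (\matrix_(i < q, j < q)
      \int[P theta z]_x (Psi x theta *m (Psi x theta)^T) i j)
}.

End Model.

(* Main.v *)
(* For fixed theta, psi_i(.; theta) has mean zero under every p(.; theta, z),
   hence along any path p_t in the nuisance submodel. Integrating it against
   p_t = p + t p nu + t p r_t gives <psi_i, nu> = - <psi_i, r_t>, which tends to
   0 by the Cauchy-Schwarz inequality. Orthogonality to the nuisance tangent
   set extends to the closure of its span by bilinearity and continuity. *)
Require Import Defs.
From mathcomp Require Import all_boot all_order all_algebra.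
From mathcomp Require Import all_classical all_reals all_analysis.
From mathcomp Require Import measurable_realfun ring.
Import Order.TTheory GRing.Theory Num.Theory.
Import numFieldNormedType.Exports.
Local Open Scope classical_set_scope.
Local Open Scope ring_scope.

(** * Change of measure through a density *)

Section density.
Context {d : measure_display} {X : measurableType d} {R : realType}.
Variables (mu : {sigma_finite_measure set X -> \bar R}).
Variables (nu : {finite_measure set X -> \bar R}) (f : X -> R).
Hypothesis mf : measurable_fun [set: X] f.
Hypothesis nuE : forall A, measurable A ->
  nu A = (\int[mu]_(x in A) (f x)%:E)%E.

Lemma density_dominates : nu `<< mu.
Proof.
apply/null_content_dominatesP => A mA muA0.
by rewrite nuE// null_set_integral//; exact/measurable_EFinP/measurable_funTS.
Qed.

(** [f] and the Radon-Nikodym derivative of [nu] have the same integral over every measurable set,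
    hence agree [mu]-almost everywhere; so [f] can replace the derivative in the change of variables
    formula. *)
Lemma integral_density (h : X -> \bar R) : nu.-integrable [set: X] h ->
  (\int[nu]_x h x = \int[mu]_x (h x * (f x)%:E))%E.
Proof.
move=> ih; have numu := density_dominates.
rewrite -(Radon_Nikodym_change_of_variables numu)//.
have mh := measurable_int _ ih.
apply: ae_eq_integral => //.
- exact: emeasurable_funM.
- by apply: emeasurable_funM => //; exact/measurable_EFinP.
apply: ae_eqe_mul2l; apply: integral_ae_eq => //.
- exact: Radon_Nikodym_integrable.
- exact/measurable_EFinP.
- by move=> A _ mA; rewrite -nuE// -Radon_Nikodym_integral.
Qed.

End density.

(** * Bilinearity and continuity of the inner product of L2 *)

Section L2_inner_product.
Context {d : measure_display} {X : measurableType d} {R : realType}.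
Variable P : probability X R.
Implicit Types f g : X -> R.

Lemma L2M_integrable f g : L2 P f -> L2 P g ->
  P.-integrable [set: X] (EFin \o (f \* g)).
Proof. by move=> f2 g2; apply/Lfun1_integrable; exact: Lfun2_mul_Lfun1. Qed.

Lemma L2_measurable f : L2 P f -> measurable_fun [set: X] f.
Proof. by move/sub_Lfun_mfun; rewrite inE. Qed.

Lemma L2_integrable f : L2 P f -> P.-integrable [set: X] (EFin \o f).
Proof.
move=> f2; apply/Lfun1_integrable; apply: Lfun_subset12 => //.
exact: fin_num_measure.
Qed.

Lemma L2_lin a f g : L2 P f -> L2 P g -> L2 P (fun x => a * f x + g x).
Proof.
have le12 : (1 <= 2%:E :> \bar R)%E by rewrite lee_fin ler1n.
have [_] := Lfun_submod_closed P le12; exact.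
Qed.

Lemma L2_cst c : L2 P (fun=> c).
Proof. exact: Lfun_cst. Qed.

Lemma L2Z a f : L2 P f -> L2 P (fun x => a * f x).
Proof.
move=> f2; rewrite (_ : (fun _ => _) = (fun x => a * f x + 0)).
  exact: L2_lin (L2_cst 0).
by apply/funext => x; rewrite addr0.
Qed.

Lemma L2D f g : L2 P f -> L2 P g -> L2 P (fun x => f x + g x).
Proof.
move=> f2 g2; rewrite (_ : (fun _ => _) = (fun x => 1 * f x + g x)).
  exact: L2_lin.
by apply/funext => x; rewrite mul1r.
Qed.

Lemma L2B f g : L2 P f -> L2 P g -> L2 P (fun x => f x - g x).
Proof.
move=> f2 g2; rewrite (_ : (fun _ => _) = (fun x => -1 * g x + f x)).
  exact: L2_lin.
by apply/funext => x; rewrite mulN1r addrC.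
Qed.

Lemma L2_sum n (F : 'I_n -> X -> R) : (forall k, L2 P (F k)) ->
  L2 P (fun x => \sum_(k < n) F k x).
Proof.
elim: n F => [|n ih] F F2.
  rewrite (_ : (fun _ => _) = (fun=> 0)); first exact: L2_cst.
  by apply/funext => x; rewrite big_ord0.
rewrite (_ : (fun _ => _) = (fun x =>
  \sum_(k < n) F (widen_ord (leqnSn n) k) x + F ord_max x)).
  by apply: L2D => //; exact: ih.
by apply/funext => x; rewrite big_ord_recr.
Qed.

Lemma L2innerDr f g h : L2 P f -> L2 P g -> L2 P h ->
  L2inner P f (fun x => g x + h x) = L2inner P f g + L2inner P f h.
Proof.
move=> f2 g2 h2; rewrite /L2inner -RintegralD//; try exact: L2M_integrable.
by congr Rintegral; apply/funext => x; rewrite mulrDr.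
Qed.

Lemma L2innerZr a f g : L2 P f -> L2 P g ->
  L2inner P f (fun x => a * g x) = a * L2inner P f g.
Proof.
move=> f2 g2; rewrite /L2inner -RintegralZl//; last exact: L2M_integrable.
by congr Rintegral; apply/funext => x; rewrite mulrCA.
Qed.

Lemma L2innerBr f g h : L2 P f -> L2 P g -> L2 P h ->
  L2inner P f (fun x => g x - h x) = L2inner P f g - L2inner P f h.
Proof.
move=> f2 g2 h2; rewrite -mulN1r -L2innerZr// -L2innerDr//; last exact: L2Z.
by congr L2inner; apply/funext => x; rewrite mulN1r.
Qed.

Lemma L2inner_sumr n f (a : 'I_n -> R) (F : 'I_n -> X -> R) : L2 P f ->
  (forall k, L2 P (F k)) ->
  L2inner P f (fun x => \sum_(k < n) a k * F k x) =
  \sum_(k < n) a k * L2inner P f (F k).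
Proof.
move=> f2; elim: n a F => [|n ih] a F F2.
  (* The right-hand zero is read as [0 * L2inner P f f], so that homogeneity turns it into the inner
     product of [f] with a zero function. *)
  rewrite big_ord0 -[RHS](mul0r (L2inner P f f)) -L2innerZr//.
  by congr L2inner; apply/funext => x; rewrite big_ord0 mul0r.
rewrite big_ord_recr/= -ih// -L2innerZr// -L2innerDr//; last 2 first.
- by apply: L2_sum => k; exact: L2Z.
- exact: L2Z.
by congr L2inner; apply/funext => x; rewrite big_ord_recr.
Qed.

(** Hölder's inequality with both exponents equal to 2 bounds the L1 norm of the product, which in
    turn bounds the absolute value of its integral. *)
Lemma L2_cauchy_schwarz f g : L2 P f -> L2 P g ->
  (`|L2inner P f g|%:E <= L2norm P f * L2norm P g)%E.
Proof.
move=> f2 g2; have /integrableP[mfg ifg] := L2M_integrable f g f2 g2.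
apply: (@le_trans _ _ ('N[P]_1[EFin \o (f \* g)%R])%E); last first.
  apply: hoelder => //; try exact: L2_measurable.
  by rewrite [RHS]splitr !div1r.
rewrite Lnorm1 /L2inner /Rintegral -fine_abse; last first.
  exact: (integrable_fin_num _ (L2M_integrable f g f2 g2)).
rewrite fineK; first exact: le_abse_integral.
by rewrite abse_fin_num (integrable_fin_num _ (L2M_integrable f g f2 g2)).
Qed.

Lemma L2norm_fin_num f : L2 P f -> L2norm P f \is a fin_num.
Proof.
by move/sub_Lfun_finLfun; rewrite inE/= => f2; rewrite ge0_fin_numE ?Lnorm_ge0.
Qed.

Lemma linear_span_L2 (A : set (X -> R)) : A `<=` L2 P ->
  linear_span A `<=` L2 P.
Proof.
by move=> A2 _ [n [a [g [Ag ->]]]]; apply: L2_sum => k; exact/L2Z/A2.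
Qed.

(** For [h] in [A], the inner product of [f] with [g] equals that with [g - h], and Cauchy-Schwarz
    makes the latter small as [h] approaches [g]. *)
Lemma L20_closure_orthogonal (A : set (X -> R)) f : L2 P f -> A `<=` L2 P ->
  (forall g, A g -> L2inner P f g = 0) ->
  forall g, L20_closure P A g -> L2inner P f g = 0.
Proof.
move=> f2 A2 fA g [[g2 _] gA].
have := L2norm_fin_num f f2; have := Lnorm_ge0 P 2%:E (EFin \o f).
rewrite -/(L2norm P f); case nf : (L2norm P f) => [c| |]// c0 _.
rewrite lee_fin in c0.
apply/eqP; rewrite -normr_le0; apply/ler_addgt0Pl => e e0; rewrite addr0.
(* The norm [c] of [f] may vanish; dividing by [c + 1] keeps the tolerance positive, and
   [c * (e / (c + 1))] is still at most [e]. *)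
have c1 : 0 < c + 1 by rewrite ltr_wpDl.
have [h Ah gh] := gA (e / (c + 1)) (divr_gt0 e0 c1).
have h2 := A2 _ Ah.
rewrite -[L2inner P f g]subr0 -(fA h Ah) -L2innerBr// -lee_fin.
apply: le_trans (L2_cauchy_schwarz _ _ f2 (L2B _ _ g2 h2)) _.
rewrite nf (le_trans (lee_wpmul2l _ (ltW gh)))// -EFinM lee_fin.
by rewrite mulrA ler_pdivrMr// mulrC ler_wpM2l ?ltW// ltrDl.
Qed.

End L2_inner_product.

(** Points of [V] other than 0 are positive, so accumulation at 0 takes place from the right.
    Properness is what allows an actual time [t] to be picked from properties that hold
    eventually. *)
Lemma within_at_right0_proper (R : realType) (V : set R) : V `<=` `[0, +oo[ ->
  limit_point V 0 -> ProperFilter (within V 0^'+).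
Proof.
move=> V0 Vlim; split; last exact: within_filter.
rewrite /within/= /at_right/= /within/= => h.
have [y [y0 Vy Uy]] := Vlim _ h.
apply: Uy (Vy); have := V0 _ Vy; rewrite /= in_itv/= andbT => y_ge0.
by rewrite lt0r y0.
Qed.

(** * Paths in the nuisance submodel and their tangents *)

Section nuisance.
Context {d : measure_display} {X : measurableType d} {R : realType}.
Context {lambda : {sigma_finite_measure set X -> \bar R}}.
Context {q : nat} {Theta : set 'cV[R]_q} {Z : Type}.
Context {P : 'cV[R]_q -> Z -> probability X R}.
Context {p : 'cV[R]_q -> Z -> X -> R}.
Hypothesis model : is_model lambda Theta P p.
Context {theta : 'cV[R]_q}.
Hypothesis theta_Theta : Theta theta.

(* Integrate psi against both sides of the expansion: psi has mean zero under
   p_t and under p, which leaves t (<psi, nu> + <psi, r_t>) = 0. *)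
Lemma path_remainder_inner (z z' : Z) (psi nu r : X -> R) (t : R) : 0 < t ->
  L20 (P theta z) psi -> L20 (P theta z') psi ->
  L2 (P theta z) nu -> L2 (P theta z) r ->
  {ae lambda, forall x, p theta z' x =
     p theta z x + t * p theta z x * nu x + t * p theta z x * r x} ->
  L2inner (P theta z) psi nu = - L2inner (P theta z) psi r.
Proof.
move=> t0 [psi2 Epsi] [psi2' Epsi'] nu2 r2 pE.
have mp w := model_measurable model w theta_Theta.
have dP w := model_density model w theta_Theta.
have one2 : L2 (P theta z) (fun=> 1) := L2_cst _ _.
have tnu2 := L2Z _ t _ nu2.
have tr2 := L2Z _ t _ r2.
(* Almost everywhere, [s] is the ratio of the densities [p theta z'] and [p theta z]. *)
pose s x := 1 + t * nu x + t * r x.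
have s2 : L2 (P theta z) s.
  by apply: L2D => //; exact: L2D.
have mpsi := L2_measurable _ _ psi2.
(* Passing to [lambda] and back, this integral is the mean of [psi] under [P theta z']. *)
have : \int[P theta z]_x (psi x * s x) = 0.
  rewrite /Rintegral.
  rewrite (integral_density _ _ _ (mp z) (dP z))//; last exact: L2M_integrable.
  rewrite -[RHS](_ : fine (\int[P theta z']_x (psi x)%:E)%E = 0); last first.
    by move: Epsi'; rewrite unlock => ->.
  rewrite (integral_density _ _ _ (mp z') (dP z'))//; last exact: L2_integrable.
  congr fine; apply: ae_eq_integral => //.
  - apply: emeasurable_funM; apply/measurable_EFinP => //.
    by apply: measurable_funM => //; exact: L2_measurable s2.
  - by apply: emeasurable_funM; apply/measurable_EFinP.
  apply: filterS pE => x pE _ /=.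
  by rewrite pE -!EFinM /s; congr EFin; ring.
rewrite -/(L2inner (P theta z) psi s) /s.
rewrite !L2innerDr ?L2innerZr//; last exact: L2D.
(* The inner product with the constant 1 is the mean of [psi] under [P theta z]. *)
rewrite (_ : L2inner _ psi (fun=> 1) = 0); last first.
  rewrite /L2inner (_ : (fun _ => _) = psi).
    by move: Epsi; rewrite unlock /Rintegral => ->.
  by apply/funext => x; rewrite mulr1.
rewrite add0r -mulrDr => /eqP; rewrite mulf_eq0 gt_eqF//= addr_eq0.
by move/eqP.
Qed.

(** The inner product with [nu] does not depend on the time [t] along the path, so one [t] with a
    small enough remainder bounds it by any given [e]. *)
Lemma nuisance_tangent_set_orthogonal (z : Z) (psi : X -> R) :
  (forall w, L20 (P theta w) psi) ->
  forall nu, nuisance_tangent_set lambda P p theta z nu ->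
  L2inner (P theta z) psi nu = 0.
Proof.
move=> psi20 nu [[nu2 _] [V [pt [r [[V0 _ Vlim] [ptP r2 ptE r0]]]]]].
have psi2 := (psi20 z).1.
have FF := within_at_right0_proper _ V V0 Vlim.
have := L2norm_fin_num _ _ psi2.
have := Lnorm_ge0 (P theta z) 2%:E (EFin \o psi).
rewrite -/(L2norm (P theta z) psi).
case npsi : (L2norm (P theta z) psi) => [c| |]// c0 _.
rewrite lee_fin in c0.
have c1 : 0 < c + 1 by rewrite ltr_wpDl.
apply/eqP; rewrite -normr_le0; apply/ler_addgt0Pl => e e0; rewrite addr0.
have rsmall : \forall t \near within V 0^'+,
    (L2norm (P theta z) (r t) < (e / (c + 1))%:E)%E.
  apply: (r0 [set y | (y < (e / (c + 1))%:E)%E]); apply: open_ereal_lt'.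
  by rewrite lte_fin divr_gt0.
have Vt : \forall t \near within V 0^'+, V t by exact: withinT.
have t_gt0 : \forall t \near within V 0^'+, 0 < t.
  by apply: (cvg_within (F := 0^'+)); exact: nbhs_right_gt.
(* The chosen [t] lies in [V], so that the expansion holds there, and is positive, so that it can be
   cancelled. *)
have [t [[rt Vt'] t0]] := filter_ex (filterI (filterI rsmall Vt) t_gt0).
have [w _ ptw] := ptP t Vt'.
have pE := ptE t Vt'; rewrite -ptw in pE.
rewrite (path_remainder_inner z w psi nu (r t) t)//; last exact: r2.
rewrite normrN -lee_fin.
apply: le_trans (L2_cauchy_schwarz _ _ _ psi2 (r2 _ Vt')) _.
rewrite npsi (le_trans (lee_wpmul2l _ (ltW rt)))// -EFinM lee_fin.
by rewrite mulrA ler_pdivrMr// mulrC ler_wpM2l ?ltW// ltrDl.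
Qed.

End nuisance.

Theorem proposition10 (d : measure_display) (X : measurableType d)
    (R : realType) (lambda : {sigma_finite_measure set X -> \bar R})
    (q : nat) (Theta : set 'cV[R]_q) (Z : Type)
    (P : 'cV[R]_q -> Z -> probability X R)
    (p : 'cV[R]_q -> Z -> X -> R)
    (Psi : X -> 'cV[R]_q -> 'cV[R]_q) :
  is_model lambda Theta P p ->
  regular_inference_function lambda Theta P p Psi ->
  forall theta : 'cV[R]_q, Theta theta -> forall i : 'I_q,
    (\bigcap_(z in [set: Z]) nuisance_tangent_orthogonal lambda P p theta z)
      (fun x => Psi x theta i 0).
Proof.
move=> model rif theta theta_Theta i z _.
(* Mean zero is needed at every [w], not only at [z], since the paths through [p theta z] run over
   other nuisance values. *)
have psi20 w := rif_L20 rif w i theta_Theta.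
have T2 : nuisance_tangent_set lambda P p theta z `<=` L2 (P theta z).
  by move=> nu [[]].
split; first exact: psi20.
apply: L20_closure_orthogonal; first exact: (psi20 z).1.
  exact: linear_span_L2.
move=> _ [n [a [nu [Tnu ->]]]].
rewrite L2inner_sumr; [|exact: (psi20 z).1|by move=> k; exact: T2].
rewrite big1// => k _.
by rewrite (nuisance_tangent_set_orthogonal model theta_Theta)// mulr0.
Qed.
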